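(* For every integer $g\ge 2$, integer $t\ge 1$ and real $\varepsilon>0$, there exist constants $C>0$, $\rho>0$ and $n_0$ such that the following holds for every $n\ge n_0$. Let $G$ be an $n$-vertex graph satisfying $$\delta(G)\ge\left(\frac{2}{2g+1}+\varepsilon\right)n.$$ Then either $G$ contains a copy of $C_{2g-1}[t]$, or $\gamma_2(G)\le C n^{2-\rho}$.
   Context: All graphs are finite and simple. $\delta(G)$ is the minimum degree of $G$, and $C_\ell$ is the cycle of length $\ell$. For $\ell\ge 3$ and $t\ge 1$, $C_\ell[t]$ is the $t$-blow-up of $C_\ell$: the graph obtained by replacing each vertex of $C_\ell$ by an independent set of size $t$ and each edge by a complete bipartite graph between the corresponding sets. ''Contains a copy'' means contains as a (not necessarily induced) subgraph. For a graph $G$ and $X\subseteq V(G)$, $G[X]$ is the induced subgraph on $X$ and $e(\cdot)$ counts edges; define $$\gamma_2(G)=\min_{V(G)=X\cup Y}\bigl(e(G[X])+e(G[Y])\bigr),$$ the minimum being over partitions of $V(G)$ into two (possibly empty) parts $X,Y$; equivalently, $\gamma_2(G)$ is the minimum number of edges that must be deleted from $G$ to make it bipartite. *)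

(* Defs.v *)
From mathcomp Require Import all_boot.

Set Implicit Arguments.
Unset Strict Implicit.
Unset Printing Implicit Defensive.

Record sgraph := SGraph {
  vertex :> finType;
  adj : rel vertex;
  adj_sym : symmetric adj;
  adj_irr : irreflexive adj
}.

Definition degree (G : sgraph) (x : G) : nat := #|[set y | adj x y]|.

(* Every degree is at most #|G|, so this default value does not affect the
   minimum; on the graph without vertices the result is 0. *)
Definition min_degree (G : sgraph) : nat :=
  \big[minn/#|G|]_(x : G) degree x.

Definition edges (G : sgraph) : {set {set G}} :=
  [set [set p.1; p.2] | p : G * G & adj p.1 p.2].

Section Induced.
Variables (G : sgraph) (X : {set G}).

Definition induced_adj : rel {x : G | x \in X} :=
  fun x y => adj (val x) (val y).

Fact induced_sym : symmetric induced_adj.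
Proof. by move=> x y; apply: adj_sym. Qed.

Fact induced_irr : irreflexive induced_adj.
Proof. by move=> x; apply: adj_irr. Qed.

Definition induced : sgraph := SGraph induced_sym induced_irr.
End Induced.

(* A partition of the vertices into two possibly empty parts is a set X
   together with its complement.  The default value #|edges G| is the one
   obtained for X = [set: G], so it does not affect the minimum. *)
Definition gamma2 (G : sgraph) : nat :=
  \big[minn/#|edges G|]_(X : {set G})
    (#|edges (induced X)| + #|edges (induced (~: X))|).

Section Cycle.
Variable l : nat.

(* ordS is the cyclic successor i |-> i.+1 %% l.  The guard i != j only matters
   for l = 1, where it removes the loop. *)
Definition cycle_adj : rel 'I_l :=
  fun i j => (i != j) && ((j == ordS i) || (i == ordS j)).

Fact cycle_sym : symmetric cycle_adj.
Proof. by move=> i j; rewrite /cycle_adj eq_sym orbC. Qed.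

Fact cycle_irr : irreflexive cycle_adj.
Proof. by move=> i; rewrite /cycle_adj eqxx. Qed.

Definition cycle_graph : sgraph := SGraph cycle_sym cycle_irr.
End Cycle.

Section Blowup.
Variables (H : sgraph) (t : nat).

Definition blowup_adj : rel (H * 'I_t)%type := fun u v => adj u.1 v.1.

Fact blowup_sym : symmetric blowup_adj.
Proof. by move=> u v; apply: adj_sym. Qed.

Fact blowup_irr : irreflexive blowup_adj.
Proof. by move=> u; apply: adj_irr. Qed.

Definition blowup : sgraph := SGraph blowup_sym blowup_irr.
End Blowup.

Definition contains_copy (H G : sgraph) : Prop :=
  exists2 f : H -> G, injective f & forall x y : H, adj x y -> adj (f x) (f y).

(* Main.v *)
Require Import Defs.
From mathcomp Require Import all_boot all_order all_algebra.
From mathcomp Require Import boolp reals exp.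
From mathcomp Require Import zify ring.

Set Implicit Arguments.
Unset Strict Implicit.
Unset Printing Implicit Defensive.

(* Suppose that G has no C_{2g-1}[t].  By Erdős's theorem on complete k-partite
   k-uniform hypergraphs, G has at most n^l / q closed walks of length l for each
   odd l <= 2g - 1, where q is a small power of n.  The same holds, up to a
   constant factor, for every fixed odd l: the degree condition gives an average
   vertex more than two neighbours on a closed walk of odd length l >= 2g + 1, and
   three neighbours produce a shorter odd closed walk.

   Let N = n / p with p a much smaller power of n.  Call x and y linked at scale
   s if there are N^(L-1) lazy walks with an even number of steps between them,
   for L = 2^(s+1).  If x and y have N common neighbours in the linkage graph of
   scale s, they are linked at scale s + 1.  Independent sets at scale 0 have at
   most 2g vertices, so some s <= 2g admits a set S that is independent at scale
   s + 1 and has maximum size among the independent sets of scale s.  All but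
   O(N) vertices are then linked to exactly one vertex of S, and two vertices
   assigned to the same x in S are linked to each other, as otherwise they could
   replace x in S.  Let two clusters be adjacent if they span nN edges.  An odd
   closed walk of clusters would yield N^L odd closed lazy walks, too many; so the
   cluster graph is bipartite and G is bipartite up to O(nN) edges. *)


(** * A box in a dense k-partite relation *)

(** The members of [A] are picked greedily. The subtraction of [T] leaves a fraction [1/b] of [X]
    outside those already picked, so by averaging some new [x] is related to a fraction [1/b] of the
    current [Y1]. *)
Lemma common_neighbours (X Y : finType) (r : X -> Y -> bool) (b T : nat)
    (Y0 : {set Y}) :
    0 < #|X| -> 0 < #|Y0| ->
    (forall y, y \in Y0 -> #|X| <= (#|[set x | r x y]| - T) * b) ->
  exists (A : {set X}) (Y1 : {set Y}),
    [/\ #|A| = T, forall x y, x \in A -> y \in Y1 -> r x y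
      & Y1 \subset Y0 /\ #|Y0| <= #|Y1| * b ^ T].
Proof.
move=> X0 Y00; elim: T => [|T IHT] hdeg.
  by exists set0, Y0; rewrite cards0 muln1; split=> // x y; rewrite inE.
have {IHT} [|A [Y1 [cA rA [sY1 cY1]]]] := IHT.
  by move=> y /hdeg /leq_trans; apply; rewrite leq_mul2r leq_sub2l ?orbT.
have Y1_gt0 : 0 < #|Y1| by case: #|Y1| cY1 => //; lia.
pose N x := [set y in Y1 | r x y].
have [x xA Nx] : exists2 x, x \notin A & #|Y1| <= #|N x| * b.
  (* Related pairs in [~: A] times [Y1], weighted by [b], number at least [#|Y1| * #|X|], but at
     most [#|X| * #|Y1|.-1] if no [x] works. *)
  apply/exists_inP; apply: contraT => /exists_inPn hN.
  have lb : #|Y1| * #|X| <= \sum_(x in ~: A) #|N x| * b.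
    have -> : \sum_(x in ~: A) #|N x| * b
            = \sum_(y in Y1) #|[set x | r x y] :\: A| * b.
      rewrite -!big_distrl /=; congr (_ * _).
      under eq_bigr => x _ do rewrite -sum1_card.
      under [RHS]eq_bigr => y _ do rewrite -sum1_card.
      rewrite (exchange_big_dep (mem Y1)) /=; last first.
        by move=> x y _; rewrite inE => /andP[].
      by apply: eq_bigr => y yY; apply: eq_bigl => x; rewrite !inE yY.
    rewrite -sum_nat_const; apply: leq_sum => y yY1.
    apply: leq_trans (hdeg y (subsetP sY1 _ yY1)) _.
    rewrite leq_mul2r; apply/orP; right.
    rewrite -{1}(cardsID A [set x | r x y]).
    have := subset_leq_card (subsetIr [set x | r x y] A); lia.
  have ub : \sum_(x in ~: A) #|N x| * b <= #|X| * #|Y1|.-1.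
    apply: (@leq_trans (#|~: A| * #|Y1|.-1)); last by rewrite leq_mul2r max_card orbT.
    rewrite -sum_nat_const; apply: leq_sum => x; rewrite inE => xA.
    by have := hN x xA; lia.
  by have := leq_trans lb ub; rewrite mulnC leq_pmul2l //; lia.
exists (x |: A), (N x); rewrite cardsU1 xA cA; split=> //.
  move=> x' y /setU1P[->|x'A]; rewrite inE => /andP[yY1 rxy] //.
  exact: rA.
split; first by apply: subset_trans sY1; apply/subsetP=> y; rewrite inE => /andP[].
apply: leq_trans cY1 _; rewrite expnS mulnA leq_mul2r Nx orbT //.
Qed.

(** Induction on [k], peeling off the first coordinate: many tails extend by many heads,
    [common_neighbours] fixes [T] heads shared by a polynomial fraction of these tails, and the
    induction hypothesis finds a box among the tails kept. *)
Lemma box_of_density (k T : nat) : exists D E : nat,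
  forall (V : finType) (P : pred (seq V)) (q : nat),
    0 < q -> 0 < #|V| -> D * q ^ E <= #|V| ->
    #|V| ^ k <= q * #|[set s : k.-tuple V | P s]| ->
  exists A : seq {set V},
    [/\ size A = k, all (fun B : {set V} => #|B| == T) A
      & forall s, all2 (fun x (B : {set V}) => x \in B) s A -> P s].
Proof.
elim: k => [|k [D [E IH]]].
  exists 0, 0 => V P q q0 V0 _; rewrite expn0 => cP.
  exists [::]; split=> // -[|//] _.
  have /card_gt0P[s] : 0 < #|[set s : 0.-tuple V | P s]| by lia.
  by rewrite inE tuple0.
(* The summand [4 * T] pays for discarding [T] heads; the rest meets the size requirement of the
   induction hypothesis with [2 * q * (4 * q) ^ T] in place of [q]. *)
exists (4 * T + D * 2 ^ E * 4 ^ (T * E)), (1 + E * (T + 1)) => V P q q0 V0 hD cP.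
pose r (x : V) (y : k.-tuple V) := P (x :: y).
(* Tails with at least [#|V| / (2 * q)] heads; the others carry at most half of the guaranteed
   number of tuples. *)
pose Y0 := [set y : k.-tuple V | #|V| <= #|[set x | r x y]| * (2 * q)].
have cE : #|[set s : k.+1.-tuple V | P s]| = \sum_(y : k.-tuple V) #|[set x | r x y]|.
  under eq_bigr => y _ do rewrite -sum1_card.
  rewrite pair_big_dep /= sum1_card /=.
  have f_inj : injective (fun yx : k.-tuple V * V => cons_tuple yx.2 yx.1).
    by move=> [y x] [y' x'] /(congr1 val) [/= -> /val_inj ->].
  rewrite -[RHS](card_imset _ f_inj).
  apply: eq_card => s; rewrite !inE; apply/idP/imsetP.
    case/tupleP: s => x y Ps; exists (y, x) => //.
    by have : x \in [set x | r x y] by rewrite inE.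
  case=> -[y x] rxy ->; have : x \in [set x | r x y] by [].
  by rewrite inE.
have cY0 : #|V| ^ k <= #|Y0| * (2 * q).
  have : #|[set s : k.+1.-tuple V | P s]| * (2 * q) <= #|Y0| * #|V| * (2 * q) + #|V| ^ k * #|V|.
    rewrite cE (bigID (mem Y0)) /= mulnDl; apply: leq_add.
      rewrite leq_mul2r; apply/orP; right; rewrite -sum_nat_const.
      by apply: leq_sum => y _; apply: max_card.
    rewrite big_distrl /= -card_tuple -sum_nat_const.
    rewrite [X in _ <= X](bigID (mem Y0)) /=; apply: leq_trans (leq_addl _ _).
    by apply: leq_sum => y; rewrite inE -ltnNge => /ltnW.
  move: cP; rewrite expnS -(leq_pmul2r V0).
  set a := #|V| ^ k; set c := #|[set s : _ | _]|; nia.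
have qs : 0 < q ^ (E * (T + 1)) by rewrite expn_gt0 q0.
have Y00 : 0 < #|Y0|.
  rewrite lt0n; apply/eqP=> z; move: cY0; rewrite z leqn0 expn_eq0; lia.
have hq : 4 * T * q <= #|V|.
  apply: leq_trans hD; rewrite expnD expn1; nia.
have [|A [Y1 [cA rA [sY1 cY1]]]] := @common_neighbours _ _ r (4 * q) T Y0 V0 Y00.
  by move=> y; rewrite inE; nia.
have [||||B [sB cB hB]] := IH V (fun s => [forall x in A, P (x :: s)]) (2 * q * (4 * q) ^ T).
- by rewrite !muln_gt0 q0 expn_gt0 muln_gt0 q0.
- by [].
- apply: leq_trans hD.
  rewrite !expnMn -!expnM expnD expn1 mulnDr muln1 expnD [T * E]mulnC.
  set u := q ^ (E * T); set v := q ^ E; set w := 4 ^ _; set z := 2 ^ E.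
  have -> : D * (z * v * (w * u)) = D * z * w * (u * v) by lia.
  rewrite leq_mul ?leq_addl //; nia.
- apply: leq_trans cY0 _; rewrite -[(2 * q * _) * _]mulnA mulnC leq_mul2l.
  apply/orP; right; apply: leq_trans cY1 _; rewrite mulnC leq_mul2l; apply/orP; right.
  apply: subset_leq_card; apply/subsetP=> y yY1; rewrite inE.
  by apply/forall_inP=> x xA; apply: rA.
exists (A :: B); split=> /=; first by rewrite sB.
  by rewrite cA eqxx.
by case=> [|x s] //= /andP[xA /hB /forall_inP]; apply.
Qed.

(** * Blow-ups of odd cycles *)

(** Greedy choice: fewer than [#|I|] elements are taken when the next index is served. *)
Lemma distinct_representatives (I V : finType) (A : I -> {set V}) :
  (forall i, #|I| <= #|A i|) ->
  exists2 f : I -> V, injective f & forall i, f i \in A i.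
Proof.
move=> cA.
have [f f_inj fA] : exists2 f : I -> V,
    {in enum I &, injective f} & forall i, f i \in A i; last first.
  by exists f => // i j; apply: f_inj; rewrite mem_enum.
have := enum_uniq I; have : size (enum I) <= #|I| by rewrite cardE.
elim: (enum I) => [_ _|i r IH /= sr /andP[ir ur]].
  have A_neq0 i : exists x, x \in A i.
    apply/card_gt0P; apply: leq_trans (cA i).
    by apply/card_gt0P; exists i.
  by exists (fun i => xchoose (A_neq0 i)) => // i; apply: xchooseP.
have [f f_inj fA] := IH (ltnW sr) ur.
have [x xA xf] : exists2 x, x \in A i & x \notin map f r.
  apply/exists_inP; apply: contraT => /exists_inPn sub.
  have : #|A i| <= size (map f r).
    rewrite cardE; apply: uniq_leq_size; first exact: enum_uniq.
    by move=> x; rewrite mem_enum => /sub; rewrite negbK.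
  by rewrite size_map leqNgt (leq_trans sr).
exists (fun j => if j == i then x else f j); last by move=> j; case: eqP => [->|].
move=> j k; rewrite !inE.
case: eqP => [->|_] /=; case: eqP => [->|_] //= jr kr.
- by move=> xE; case/mapP: xf; exists k.
- by move=> xE; case/mapP: xf; exists j.
- exact: f_inj.
Qed.

Lemma cycle_nth (T : Type) (e : rel T) (x0 : T) (s : seq T) (i : nat) :
  cycle e s -> i < size s -> e (nth x0 s i) (nth x0 s (i.+1 %% size s)).
Proof.
case: s => // x p /(pathP x0) /= H ip.
have := H i; rewrite size_rcons => /(_ ip).
rewrite -rcons_cons !nth_rcons /= ip.
case: (ltngtP i (size p)) => [lt|gt|->]; last by rewrite modnn.
  by rewrite modn_small.
by lia.
Qed.

(* A homomorphism from any odd cycle of length at least [l] to the cycle of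
   length [l], for [l] odd. *)
Definition wrap (l i : nat) : nat :=
  if i < l then i else if odd i then 0 else l.-1.

(** Since [wrap] folds the long cycle onto the short one, the copies of [i] can be taken in side
    [wrap l i] of the box. Sides may overlap, but with [L * t] elements each they admit distinct
    representatives for all vertices of the blow-up. *)
Lemma blowup_of_box (G : sgraph) (l L t : nat) (A : seq {set G}) :
  odd l -> odd L -> 2 < l <= L -> 0 < t -> size A = l ->
  all (fun B : {set G} => #|B| == L * t) A ->
  (forall s, all2 (fun x (B : {set G}) => x \in B) s A -> cycle (@adj G) s) ->
  contains_copy (blowup (cycle_graph L) t) G.
Proof.
move=> ol oL /andP[l2 lL] t0 sA cA boxA.
have cA' i : i < l -> #|nth set0 A i| = L * t.
  by move=> il; apply/eqP; apply: (allP cA); rewrite mem_nth ?sA.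
have [|f f_inj fA] := @distinct_representatives ('I_L * 'I_t)%type _
    (fun i => nth set0 A (wrap l i.1)).
  move=> i; rewrite card_prod !card_ord cA' // /wrap.
  by case: (ltnP i.1 l) => // _; case: odd; lia.
have L0 : 0 < L by lia.
pose x0 : G := f (Ordinal L0, Ordinal t0).
(* Arbitrary members of the other sides complete [u] and [v] to a tuple of the box, a closed walk in
   which they are consecutive. *)
have adjA i u v : i < l -> u \in nth set0 A i -> v \in nth set0 A (i.+1 %% l) -> adj u v.
  move=> il uA vA.
  pose s := mkseq (fun j => if j == i then u else if j == i.+1 %% l then v
                            else odflt x0 [pick x in nth set0 A j]) l.
  have ss : size s = l by rewrite size_mkseq.
  have cs : cycle (@adj G) s.
    apply: boxA; rewrite all2E ss sA eqxx /=.
    apply/(all_nthP (x0, set0)) => j; rewrite size_zip ss sA minnn => jl.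
    rewrite nth_zip ?ss ?sA //= nth_mkseq //.
    case: eqP => [->//|_]; case: eqP => [->//|_].
    case: pickP => //= A0; have := cA' j jl.
    by rewrite (eq_card0 A0); nia.
  have := cycle_nth x0 cs; rewrite ss => /(_ i il).
  rewrite !nth_mkseq ?ltn_pmod ?eqxx //; last by lia.
  case: eqP => // E; move: E; have [lt|ge] := ltnP i.+1 l.
    by rewrite modn_small //; lia.
  by have -> : i.+1 = l by [lia]; rewrite modnn; lia.
have adjS (i : 'I_L) a b : adj (f (i, a)) (f (ordS i, b)).
  have := fA (i, a); have := fA (ordS i, b); rewrite /=.
  (* The cases are the closing edge of the long cycle, the edges among the first [l] positions, the
     edge from [l - 1] to [l], and the zigzag between sides [0] and [l - 1]. Oddness of [l] and [L]
     makes the ends fit. *)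
  have [iL|iL] := ltnP i.+1 L; last first.
    have iE : i.+1 = L by have := ltn_ord i; lia.
    rewrite iE modnn /wrap; have -> /= : 0 < l by lia.
    have [il|il] := ltnP i l.
      move=> hb ha; apply: (adjA i) => //.
      by have -> : i.+1 = l by [lia]; rewrite modnn.
    have /negbTE -> : ~~ odd i by have : odd i.+1 by rewrite iE.
    move=> hb ha; apply: (adjA l.-1) => //; first by lia.
    by rewrite prednK ?modnn //; lia.
  rewrite modn_small // /wrap.
  have [il|il] := ltnP i.+1 l.
    have -> : i < l by lia.
    by move=> hb ha; apply: (adjA i); rewrite ?modn_small //; lia.
  have [il'|il'] := ltnP i l.
    have iE : i.+1 = l by lia.
    rewrite iE ol => hb ha; apply: (adjA i) => //; by rewrite iE modnn.
  rewrite /=; case: odd => /= hb ha; last first.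
    apply: (adjA l.-1) => //; first by lia.
    by rewrite prednK ?modnn //; lia.
  rewrite adj_sym; apply: (adjA l.-1) => //; first by lia.
  by rewrite prednK ?modnn //; lia.
exists f => // -[i a] [j b]; rewrite /= /blowup_adj /= /cycle_adj.
by case/andP=> _ /orP[/eqP->|/eqP->]; rewrite // adj_sym.
Qed.

(** * Short odd closed walks *)

Definition closed_walks (G : sgraph) (l : nat) : nat :=
  #|[set s : l.-tuple G | cycle (@adj G) s]|.

(** A larger density of closed walks would give a box by [box_of_density], hence the blow-up by
    [blowup_of_box]. Length 1 is excluded by irreflexivity. *)
Lemma few_short_odd_closed_walks (L t : nat) : odd L -> 0 < t ->
  exists D E : nat, forall (G : sgraph) (q : nat),
    ~ contains_copy (blowup (cycle_graph L) t) G ->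
    0 < q -> 0 < #|G| -> D * q ^ E <= #|G| ->
    forall l, odd l -> l <= L -> closed_walks G l * q <= #|G| ^ l.
Proof.
move=> oL t0.
have bound l : exists D E : nat, forall (G : sgraph) (q : nat),
    ~ contains_copy (blowup (cycle_graph L) t) G ->
    0 < q -> 0 < #|G| -> D * q ^ E <= #|G| ->
    odd l -> l <= L -> closed_walks G l * q <= #|G| ^ l.
  have [D [E box]] := box_of_density l (L * t); exists D, E => G q noC q0 G0 hD ol lL.
  have [l2|l2] := ltnP 2 l; last first.
    have -> : l = 1 by lia.
    rewrite /closed_walks eq_card0 // => s; rewrite inE.
    by case: s => -[|x []] //= i; rewrite adj_irr.
  case: leqP => // /ltnW; rewrite mulnC => /(box _ _ _ q0 G0 hD) [A [sA cA bA]].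
  by case: noC; apply: (@blowup_of_box _ l L t A); rewrite ?l2.
suff [D [E H]] : exists D E : nat, forall (G : sgraph) (q l : nat),
    ~ contains_copy (blowup (cycle_graph L) t) G ->
    0 < q -> 0 < #|G| -> D * q ^ E <= #|G| ->
    odd l -> l <= L -> l < L.+1 -> closed_walks G l * q <= #|G| ^ l.
  by exists D, E => G q noC q0 G0 hD l ol lL; apply: H.
elim: L.+1 => [|k [D [E IH]]]; first by exists 0, 0.
have [D' [E' IH']] := bound k; exists (D + D'), (E + E') => G q l noC q0 G0 hD ol lL.
have qE : 0 < q ^ E by rewrite expn_gt0 q0.
have qE' : 0 < q ^ E' by rewrite expn_gt0 q0.
rewrite ltnS leq_eqVlt => /orP[/eqP lk|lk].
  by rewrite lk in ol lL *; apply: IH' => //; move: hD; rewrite expnD; nia.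
by apply: IH => //; move: hD; rewrite expnD; nia.
Qed.

(** * Long odd closed walks *)

(** Three points at pairwise cyclic distance two would force length 6, which is even. *)
Lemma three_point_gaps (l i j k : nat) : odd l -> 4 < l -> i < j -> j < k -> k < l ->
  [\/ j != i + 2 /\ j + 2 != i + l, k != j + 2 /\ k + 2 != j + l
    | k != i + 2 /\ k + 2 != i + l].
Proof.
move=> ol l4 ij jk kl; have l6 : l != 6 by apply: contraTneq ol => ->.
have [e1|n1] := eqVneq j (i + 2); have [e2|n2] := eqVneq (j + 2) (i + l);
  [| |
  | by constructor 1];
  have [e3|n3] := eqVneq k (j + 2); have [e4|n4] := eqVneq (k + 2) (j + l);
  try (by constructor 2); clear ol; try (by exfalso; lia);
  by constructor 3; split; lia.
Qed.

(** Exactly one of the complementary arcs [d] and [l - d] is odd; the other is even, positive and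
    not 2, hence at least 4. *)
Lemma odd_gap (l d : nat) : odd l -> 0 < d < l -> d != 2 -> d + 2 != l ->
  (odd d && (d + 4 <= l)) || (odd (l - d) && (l - d + 4 <= l)).
Proof.
move=> ol /andP[d0 dl] d2 d2'; rewrite (oddB (ltnW dl)) ol /=.
have := odd_double_half d; have := odd_double_half l; rewrite ol.
by case: odd => /= lE dE; rewrite ?andbT ?orbF; lia.
Qed.

(** Applied to the positions adjacent to a vertex [v]: together with [v], an odd arc of length [b]
    forms a closed walk of odd length [b + 2 <= l - 2]. *)
Lemma odd_arc (l : nat) (a : pred nat) : odd l -> 4 < l ->
    2 < #|[set i : 'I_l | a i]| ->
  exists i b : 'I_l, [/\ odd b, b + 4 <= l, a i & a ((i + b) %% l)].
Proof.
move=> ol l4 /card_gt2P[x [y [z [[]]]]].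
rewrite !inE => ax ay az [xy yz zx].
have [i [j [k [ai aj ak ij jk]]]] : exists i j k : 'I_l, [/\ a i, a j, a k, i < j & j < k].
  move: xy yz zx; rewrite -!val_eqE /=.
  case: (ltngtP x y) => // xy _; case: (ltngtP y z) => // yz _; case: (ltngtP z x) => // zx _.
  - by have := ltn_trans zx (ltn_trans xy yz); rewrite ltnn.
  - by exists x, y, z.
  - by exists z, x, y.
  - by exists x, z, y.
  - by exists y, z, x.
  - by exists y, x, z.
  - by exists z, y, x.
  - by have := ltn_trans zx (ltn_trans yz xy); rewrite ltnn.
have arc (u v : 'I_l) : a u -> a v -> u < v -> v != u + 2 :> nat -> v + 2 != u + l :> nat ->
    exists i b : 'I_l, [/\ odd b, b + 4 <= l, a i & a ((i + b) %% l)].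
  move=> au av uv n2 n2'; have vl := ltn_ord v.
  have dl : v - u < l by rewrite (leq_ltn_trans (leq_subr _ _)).
  have dl' : l - (v - u) < l by rewrite ltn_subrL subn_gt0 uv (leq_ltn_trans _ vl).
  have [| | |/andP[od bd]|/andP[od bd]] := orP (odd_gap (l := l) (d := v - u) ol _ _ _).
  - by rewrite subn_gt0 uv.
  - by apply: contraNneq n2 => d2; rewrite -d2 subnKC // ltnW.
  - by apply: contraNneq n2' => /(congr1 (addn u)); rewrite addnA subnKC ?(ltnW uv) // => ->.
  - by exists u, (Ordinal dl); split; rewrite //= subnKC ?modn_small // ltnW.
  exists v, (Ordinal dl'); split=> //=.
  have -> : v + (l - (v - u)) = u + l.
    by rewrite -{1}(subnKC (ltnW uv)) -addnA subnKC // ltnW.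
  by rewrite modnDr modn_small.
have [[n1 n2]|[n1 n2]|[n1 n2]] := three_point_gaps ol l4 ij jk (ltn_ord k).
- exact: (arc i j).
- exact: (arc j k).
- exact: (arc i k ai ak (ltn_trans ij jk)).
Qed.

Section ShorterWalks.
Variables (G : sgraph) (l : nat).

Definition arc_walks (i b : 'I_l) : {set G * l.-tuple G} :=
  [set p : G * l.-tuple G | [&& cycle (@adj G) p.2, adj p.1 (nth p.1 p.2 i)
             & adj p.1 (nth p.1 p.2 ((i + b) %% l))]].

(* The vertex [p.1] closes the arc of length [b] into a walk of length [b + 2];
   the rest of the long walk is unconstrained. *)
Lemma card_arc_walks (i b : 'I_l) :
  #|arc_walks i b| <= closed_walks G b.+2 * #|G| ^ (l - b.+1).
Proof.
rewrite -(card_tuple (l - b.+1)) -cardsT -cardsX.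
(* The walk is rotated to start at [i] and cut after the arc. Both pieces have the prescribed
   lengths, so the defaults of [insubd] never occur. *)
pose f (p : G * l.-tuple G) : b.+2.-tuple G * (l - b.+1).-tuple G :=
  (insubd (nseq_tuple _ p.1) (p.1 :: take b.+1 (rot i p.2)),
   insubd (nseq_tuple _ p.1) (drop b.+1 (rot i p.2))).
have f1 p : (f p).1 = p.1 :: take b.+1 (rot i p.2) :> seq G.
  by rewrite val_insubd /= size_takel ?eqxx // size_rot size_tuple.
have f2 p : (f p).2 = drop b.+1 (rot i p.2) :> seq G.
  by rewrite val_insubd /= size_drop size_rot size_tuple eqxx.
have f_inj : injective f.
  move=> p p' fE; have := f1 p; have := f2 p; rewrite fE f1 f2 => E2 [E1 E1'].
  case: p p' {fE f1 f2} E1 E1' E2 => [v s] [v' s'] /= -> E1' E2.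
  congr pair; apply/val_inj/(@rot_inj i) => /=.
  by rewrite -(cat_take_drop b.+1 (rot i s)) -E1' -E2 cat_take_drop.
rewrite -(card_imset _ f_inj); apply: subset_leq_card.
apply/subsetP=> _ /imsetP[[v s] /[!inE]/= /and3P[cs vi vb] ->]; rewrite andbT f1 /=.
move: cs; rewrite -(rot_cycle i).
have il : i < size s by rewrite size_tuple.
have nth_r k : k < l -> nth v (rot i s) k = nth v s ((i + k) %% l).
  move=> kl; rewrite /rot nth_cat size_drop size_tuple nth_drop.
  have i_lt := ltn_ord i; case: (ltnP k (l - i)) => h.
    by rewrite modn_small //; lia.
  rewrite nth_take; last by lia.
  have -> : i + k = (k - (l - i)) + l by lia.
  by rewrite modnDr modn_small //; lia.
have sr : size (rot i s) = l by rewrite size_rot size_tuple.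
have v0 : adj v (nth v (rot i s) 0).
  by rewrite nth_r ?addn0 ?modn_small //; have := ltn_ord i; lia.
have vb' : adj v (nth v (rot i s) b) by rewrite nth_r.
case: (rot i s) sr v0 vb' {nth_r} => [|x r] /= sr vx vb'; first by have := ltn_ord i; lia.
rewrite vx rcons_path => /andP[pr _].
have := ltn_ord b => bl.
have br : b <= size r by lia.
rewrite rcons_path take_path //= adj_sym.
rewrite (last_nth v) size_takel //.
by rewrite -[x :: take b r]/(take b.+1 (x :: r)) nth_take.
Qed.

(** Double counting of triples of a closed walk [s], a position [i] and a neighbour [v] of its
    vertex there. A pair [(v, s)] with at most two positions costs at most 2; any other costs at
    most [l] and lies in some [arc_walks]. *)
Lemma degree_sum_closed_walks (d : nat) :
  odd l -> 4 < l -> (forall x : G, d <= degree x) ->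
  l * d * closed_walks G l <=
    2 * #|G| * closed_walks G l
    + l * \sum_(i < l) \sum_(b < l | odd b && (b + 4 <= l)) #|arc_walks i b|.
Proof.
move=> ol l4 dG.
pose C := [set s : l.-tuple G | cycle (@adj G) s].
pose A (v : G) (s : l.-tuple G) := [set i : 'I_l | adj v (nth v s i)].
have lb : l * d * #|C| <= \sum_(s in C) \sum_v #|A v s|.
  rewrite mulnC -sum_nat_const; apply: leq_sum => s _.
  under eq_bigr => v _ do rewrite -sum1dep_card.
  rewrite (exchange_big_dep predT) //=.
  rewrite -{1}(card_ord l) -sum_nat_const; apply: leq_sum => i _.
  apply: leq_trans (dG (tnth s i)) _.
  rewrite sum1dep_card; apply: subset_leq_card; apply/subsetP=> v.
  by rewrite !inE adj_sym -tnth_nth.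
rewrite -[closed_walks G l]/(#|C|); apply: leq_trans lb _.
have -> : \sum_(i < l) \sum_(b < l | odd b && (b + 4 <= l)) #|arc_walks i b|
   = \sum_(s in C) \sum_v \sum_(i < l) \sum_(b < l | odd b && (b + 4 <= l))
       ((v, s) \in arc_walks i b).
  pose F v s := if s \in C then \sum_(i < l) \sum_(b < l | odd b && (b + 4 <= l))
    ((v, s) \in arc_walks i b : nat) else 0.
  transitivity (\sum_(p : G * l.-tuple G) F p.1 p.2); last first.
    rewrite -(pair_bigA _ F) exchange_big /= [RHS]big_mkcond /=.
    by apply: eq_bigr => s _; rewrite /F; case: ifP => // _; rewrite big1.
  rewrite pair_big_dep /=.
  under eq_bigr => p _ do rewrite -sum1_card big_mkcond /=.
  rewrite exchange_big /=; apply: eq_bigr => -[v s] _.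
  rewrite /F pair_big_dep /=; case: ifP => sC.
    by apply: eq_bigr => p _; case: (_ \in _).
  by apply: big1 => p _; rewrite !inE /= in sC *; rewrite sC.
rewrite [2 * _ * _]mulnC -sum_nat_const big_distrr /= -big_split /=.
apply: leq_sum => s; rewrite inE => cs.
rewrite mulnC -sum_nat_const big_distrr /= -big_split /=.
apply: leq_sum => v _; have [A2|A2] := leqP #|A v s| 2; first exact: leq_trans A2 (leq_addr _ _).
have [i [b [ob bl vi vb]]] := odd_arc (a := fun k => adj v (nth v s k)) ol l4 A2.
apply: leq_trans (leq_addl _ _); apply: (@leq_trans (l * 1)).
  by rewrite muln1 -[X in _ <= X](card_ord l) max_card.
rewrite leq_mul2l; apply/orP; right.
rewrite (bigD1 i) //= (bigD1 b) /=; last by rewrite ob bl.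
by rewrite inE /= cs vi vb.
Qed.
End ShorterWalks.

(** For odd [l > L] the degree condition makes [l * d] exceed [2 * #|G|] by at least [#|G| / e].
    This surplus in [degree_sum_closed_walks] bounds the closed walks of length [l] by shorter odd
    ones. *)
Lemma few_odd_closed_walks (L e m : nat) : odd L -> 2 < L -> exists K : nat,
  forall (G : sgraph) (q : nat), 0 < #|G| ->
    (forall x : G, (2 * e + 1) * #|G| <= e * (L + 2) * degree x) ->
    (forall l, odd l -> l <= L -> closed_walks G l * q <= #|G| ^ l) ->
    forall l, odd l -> l <= m -> closed_walks G l * q <= K * #|G| ^ l.
Proof.
move=> oL L2; elim: m => [|m [K IH]]; first by exists 0 => G q _ _ _ [].
(* The 1 serves lengths up to [L]. In the last term [e] inverts the surplus, and the cube is the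
   factor [l] of the degree sum times [l ^ 2] choices of an arc. *)
exists (1 + K + e * m.+1 ^ 3 * K) => G q G0 dG short l ol.
set n := #|G| in G0 dG short *.
have {}IH := IH G q G0 dG short.
rewrite leq_eqVlt ltnS => /orP[/eqP lm|lm]; last first.
  by apply: leq_trans (IH l ol lm) _; rewrite leq_mul2r; apply/orP; right; nia.
have [lL|lL] := leqP l L.
  by apply: leq_trans (short l ol lL) _; rewrite leq_pmull.
have l4 : 4 < l by lia.
have [d hd1 hd2] :
    exists2 d, (2 * e + 1) * n <= e * (L + 2) * d & forall x : G, d <= degree x.
  have /card_gt0P[x0 _] := G0.
  exists (degree [arg min_(x < x0) degree x]) => [|x]; first exact: dG.
  by case: arg_minnP => // y _; apply.
have := degree_sum_closed_walks ol l4 hd2.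
set cl := closed_walks G l; set S := \sum_(i < l) _ => main.
have SB : S * q <= l * l * (K * n ^ l.+1).
  have const_sum c : l * c = \sum_(i < l) c by rewrite sum_nat_const card_ord.
  rewrite big_distrl /= -mulnA const_sum; apply: leq_sum => i _.
  rewrite big_distrl /= const_sum.
  rewrite [X in _ <= X](bigID (fun b : 'I_l => odd b && (b + 4 <= l))) /=.
  apply: leq_trans (leq_addr _ _); apply: leq_sum => b /andP[ob bl].
  apply: (@leq_trans (closed_walks G b.+2 * n ^ (l - b.+1) * q)).
    by rewrite leq_mul2r card_arc_walks orbT.
  have : closed_walks G b.+2 * q <= K * n ^ b.+2 by apply: IH => //=; lia.
  have -> : l.+1 = b.+2 + (l - b.+1) by lia.
  rewrite expnD; set u := closed_walks _ _; set w := n ^ _; set z := n ^ b.+2.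
  by nia.
have el : e * (L + 2) * d <= e * l * d by rewrite leq_mul2r leq_mul2l; lia.
rewrite -lm; move: SB main hd1 el; rewrite expnS.
move: S cl (n ^ l) => S cl N SB main hd1 el.
suff : n * (cl * q) <= n * (e * l ^ 3 * K * N).
  rewrite leq_pmul2l // => H; apply: leq_trans H _; nia.
have h1 : (2 * e + 1) * n * (cl * q) <= e * l * d * (cl * q).
  by rewrite leq_mul2r (leq_trans hd1 el) orbT.
have h2 : e * q * (l * d * cl) <= e * q * (2 * n * cl + l * S) by rewrite leq_mul2l main orbT.
have h3 : e * l * (S * q) <= e * l * (l * l * (K * (n * N))) by rewrite leq_mul2l SB orbT.
rewrite !expnS expn0 muln1; nia.
Qed.

(** * Lazy walks *)

Section LazyWalks.
Variables (G : sgraph) (N : nat).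

(** Grows at its end while [lazy_walks] unfolds at its start, so that a genuine step can pass from
    the second to the first. *)
Fixpoint walks (l : nat) (x y : G) : nat :=
  if l is l'.+1 then \sum_z walks l' x z * adj z y else x == y.

(* Walks of length [L] which may pause, each pause having weight [N], and whose
   number of genuine steps has parity [p]. *)
Fixpoint lazy_walks (L : nat) (p : bool) (x y : G) : nat :=
  if L is L'.+1 then N * lazy_walks L' p x y + \sum_z adj x z * lazy_walks L' (~~ p) z y
  else (x == y) && ~~ p.

Lemma lazy_walks_pause (k L : nat) (p : bool) (x y : G) :
  N ^ k * lazy_walks L p x y <= lazy_walks (k + L) p x y.
Proof.
elim: k => [|k IH]; first by rewrite mul1n.
rewrite addSn expnS -mulnA /=; apply: leq_trans (leq_addr _ _).
by rewrite leq_mul2l IH orbT.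
Qed.

Lemma lazy_walks_comp (a b : nat) (p r : bool) (x z : G) :
  \sum_y lazy_walks a p x y * lazy_walks b r y z <= lazy_walks (a + b) (p (+) r) x z.
Proof.
elim: a p x => [|a IH] p x.
  rewrite (bigD1 x) //= big1 ?addn0 => [|y /negPf]; last by rewrite eq_sym => ->.
  by rewrite eqxx; case: p; rewrite ?mul0n ?mul1n.
rewrite addSn /=.
under eq_bigr => y _ do rewrite mulnDl -mulnA big_distrl /=.
rewrite big_split /= -big_distrr /= leq_add ?leq_mul2l ?IH ?orbT //.
rewrite exchange_big; apply: leq_sum => u _ /=.
under eq_bigr => y _ do rewrite -mulnA.
by rewrite -big_distrr /= leq_mul2l -addNb IH orbT.
Qed.

Lemma lazy_walk_adj (x y : G) : adj x y -> 0 < lazy_walks 1 true x y.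
Proof.
by move=> xy; rewrite /= (bigD1 y) //= eqxx xy; lia.
Qed.

Lemma lazy_walks_codegree (x y : G) :
  #|[set z | adj x z && adj y z]| <= lazy_walks 2 false x y.
Proof.
apply: leq_trans (lazy_walks_comp 1 1 true true x y).
rewrite -sum1_card big_mkcond /=; apply: leq_sum => z _.
rewrite inE; case: andP => // -[xz yz].
by rewrite muln_gt0 !lazy_walk_adj // adj_sym.
Qed.

Lemma walks_tuples (l : nat) (x y : G) :
  walks l x y <= #|[set s : l.-tuple G | path (@adj G) x s && (last x s == y)]|.
Proof.
elim: l y => [|l IH] y /=.
  case: eqP => // xy; apply/card_gt0P; exists [tuple]; by rewrite inE /= xy eqxx.
pose f (s : l.-tuple G) := [tuple of rcons s y].
have f_inj : injective f.
  by move=> s s' /(congr1 val) /= /rcons_inj [/val_inj].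
apply: (@leq_trans #|[set s : l.-tuple G | path (@adj G) x s && adj (last x s) y]|); last first.
  rewrite -(card_imset _ f_inj); apply: subset_leq_card.
  by apply/subsetP=> _ /imsetP[s /[!inE] h ->]; rewrite /= rcons_path last_rcons h eqxx.
apply: (@leq_trans (\sum_z
    #|[set s : l.-tuple G | path (@adj G) x s && (last x s == z)]| * adj z y)).
  by apply: leq_sum => z _; rewrite leq_mul2r IH orbT.
under eq_bigr => z _ do rewrite -sum1dep_card big_distrl big_mkcond /=.
rewrite exchange_big -sum1dep_card [X in _ <= X]big_mkcond; apply: leq_sum => s _ /=.
rewrite (bigD1 (last x s)) //= eqxx big1 ?addn0.
  by case: path; case: adj.
by move=> z /negPf; rewrite eq_sym => ->; rewrite andbF.
Qed.

Lemma walks_closed_walks (l : nat) :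
  \sum_x walks l.+1 x x <= closed_walks G l.+1.
Proof.
apply: (@leq_trans (\sum_x
    #|[set s : l.+1.-tuple G | path (@adj G) x s && (last x s == x)]|)).
  by apply: leq_sum => x _; apply: walks_tuples.
under eq_bigr => x _ do rewrite -sum1dep_card big_mkcond.
rewrite exchange_big /closed_walks -sum1dep_card [X in _ <= X]big_mkcond; apply: leq_sum => s _ /=.
case: s => -[|a s] //= _; rewrite (bigD1 (last a s)) //= eqxx andbT big1 ?addn0.
  by rewrite rcons_path andbC.
by move=> x /negPf; rewrite eq_sym => ->; rewrite andbF.
Qed.

(** There are [2 ^ L] patterns of pauses; a pattern with [j] pauses contributes [N ^ j] times a
    number of odd closed walks of length [L - j], and [N <= #|G|]. *)
Lemma lazy_walks_bound (K q m : nat) : N <= #|G| ->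
    (forall l, odd l -> l <= m -> closed_walks G l * q <= K * #|G| ^ l) ->
  forall L, L <= m ->
    (\sum_x lazy_walks L true x x) * q <= K * 2 ^ L * #|G| ^ L.
Proof.
move=> Nn few.
(* Generalised to a genuine walk of length [l] followed by a lazy walk back, with an odd number of
   genuine steps in all. *)
suff H L l p : odd l (+) p -> l + L <= m ->
    (\sum_x \sum_y walks l x y * lazy_walks L p y x) * q <= K * 2 ^ L * #|G| ^ (l + L).
  move=> L Lm; apply: leq_trans (H L 0 true _ _) => //.
  rewrite leq_mul2r; apply/orP; right; apply: leq_sum => x _.
  by rewrite (bigD1 x) //= eqxx mul1n leq_addr.
elim: L l p => [|L IH] l p lp lL.
  case: p lp; rewrite ?addbT ?addbF => lp.
    by rewrite big1 // => x _; rewrite big1 // => y _; rewrite /= andbF muln0.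
  rewrite addn0 muln1 in lL *; apply: leq_trans (few l lp lL).
  rewrite leq_mul2r; apply/orP; right.
  case: l lp {lL} => // l _; apply: leq_trans (walks_closed_walks l).
  apply: leq_sum => x _; rewrite (bigD1 x) //= eqxx muln1 [X in _ + X]big1 ?addn0 //.
  by move=> y /negPf ->; rewrite muln0.
have -> : \sum_x \sum_y walks l x y * lazy_walks L.+1 p y x
   = N * (\sum_x \sum_y walks l x y * lazy_walks L p y x)
     + \sum_x \sum_y walks l.+1 x y * lazy_walks L (~~ p) y x.
  rewrite big_distrr -big_split; apply: eq_bigr => x _ /=.
  under eq_bigr => y _ do rewrite mulnDr mulnCA.
  rewrite big_split -big_distrr /=; congr (_ + _).
  under eq_bigr => y _ do rewrite big_distrr.
  under [RHS]eq_bigr => y _ do rewrite big_distrl.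
  rewrite exchange_big; apply: eq_bigr => y _; apply: eq_bigr => z _ /=.
  by rewrite mulnA.
have h1 := IH l p lp (ltnW (leq_trans (eq_leq (esym (addnS l L))) lL)).
have h2 : (\sum_x \sum_y walks l.+1 x y * lazy_walks L (~~ p) y x) * q
   <= K * 2 ^ L * #|G| ^ (l.+1 + L).
  by apply: IH; [rewrite /= addNb addbN negbK | rewrite addSnnS].
rewrite addnS addSn !expnS in h2 *.
move: h1 h2; set u := \sum_x _; set v := \sum_x _; set w := #|G| ^ _; set n := #|G| in Nn *.
move: (2 ^ L) => z h1 h2.
have h3 : N * (u * q) <= n * (K * z * w) by apply: leq_mul.
nia.
Qed.
End LazyWalks.

(** * Clusters *)

(** The diagonal is exempt because linkage is reflexive. *)
Definition independent (V : finType) (H : rel V) (S : {set V}) : bool :=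
  [forall x in S, forall y in S, H x y ==> (x == y)].

Lemma independentP (V : finType) (H : rel V) (S : {set V}) :
  reflect {in S &, forall x y, H x y -> x = y} (independent H S).
Proof.
apply: (iffP forall_inP) => [iS x y xS yS Hxy|iS x xS].
  by apply/eqP/(implyP (forall_inP (iS x xS) y yS)).
by apply/forall_inP => y yS; apply/implyP => /(iS x y xS yS) ->.
Qed.

Lemma card_bigcup_leq (I V : finType) (P : pred I) (F : I -> {set V}) (c : nat) :
  (forall i, P i -> #|F i| <= c) -> #|\bigcup_(i | P i) F i| <= #|I| * c.
Proof.
move=> Fc; apply: (@leq_trans (\sum_(i | P i) #|F i|)).
  elim/big_rec2: _ => [|i s U _ IH]; first by rewrite cards0.
  by rewrite (leq_trans (leq_card_setU _ _).1) // leq_add2l.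
rewrite -sum_nat_const big_mkcond /=; apply: leq_sum => i _.
by case: ifP => // /Fc.
Qed.

Section Clusters.
Variables (V : finType) (H H' : rel V) (S : {set V}) (N : nat).
Hypotheses (H_refl : reflexive H) (H_sym : symmetric H) (sHH' : subrel H H').
Hypothesis H'_common : forall x y, N <= #|[set z | H x z && H y z]| -> H' x y.
Hypotheses (S_indep : independent H' S)
           (S_max : forall S', independent H S' -> #|S'| <= #|S|).

Definition cluster (x : V) : {set V} :=
  [set y | H x y && [forall x' in S, H x' y ==> (x' == x)]].

Definition unclustered : {set V} := ~: \bigcup_(x in S) cluster x.

Lemma independent_center : {in S &, forall x y, H x y -> x = y}.
Proof. by move=> x y xS yS /sHH'; apply: (independentP _ _ S_indep). Qed.

(** Exchange argument: otherwise replacing [x] in [S] by both [y] and [z] gives a larger independent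
    set for [H]. *)
Lemma cluster_related x y z : x \in S -> y \in cluster x -> z \in cluster x -> H y z.
Proof.
move=> xS /[!inE] /andP[xy /forall_inP uy] /andP[xz /forall_inP uz].
have {}uy x' : x' \in S -> H x' y -> x' = x by move=> x'S /(implyP (uy x' x'S))/eqP.
have {}uz x' : x' \in S -> H x' z -> x' = x by move=> x'S /(implyP (uz x' x'S))/eqP.
apply: contraT => yz; have yz' : y != z by apply: contraNneq yz => ->; rewrite H_refl.
have yS : y \notin S :\ x by apply/setD1P => -[/eqP yx /uy]; rewrite H_refl => /(_ isT).
have zS : z \notin S :\ x by apply/setD1P => -[/eqP zx /uz]; rewrite H_refl => /(_ isT).
have : #|y |: (z |: S :\ x)| <= #|S|.
  apply/S_max/independentP => a b.
  have only c w : (forall x', x' \in S -> H x' w -> x' = x) -> c \in S :\ x -> H c w -> False.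
    by move=> uw /setD1P[/eqP cx /uw h] /h.
  case/setU1P=> [->|/setU1P[->|aS]]; case/setU1P=> [->|/setU1P[->|bS]] //.
  - by rewrite (negPf yz).
  - by rewrite H_sym => /(only _ _ uy bS).
  - by rewrite H_sym (negPf yz).
  - by rewrite H_sym => /(only _ _ uz bS).
  - by move=> /(only _ _ uy aS).
  - by move=> /(only _ _ uz aS).
  by case/setD1P: aS bS => _ aS /setD1P[_ bS]; apply: independent_center.
rewrite !cardsU1 (negPf zS) (cardsD1 x S) xS in_setU1 (negPf yz') (negPf yS).
by rewrite !add1n ltnn.
Qed.

(** By maximality each vertex is related to some centre, so an unclustered one is related to two.
    Distinct centres have fewer than [N] common neighbours, as they are not related by [H']. *)
Lemma card_unclustered : #|unclustered| <= #|S| ^ 2 * N.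
Proof.
pose T := {x : V | x \in S}.
have -> : #|S| ^ 2 = #|{: T * T}| by rewrite card_prod !card_sig.
apply: leq_trans (card_bigcup_leq (P := fun p : T * T => p.1 != p.2)
   (F := fun p => [set z | H (val p.1) z && H (val p.2) z]) _); last first.
  move=> [[x xS] [y yS]]; rewrite -val_eqE /= => xy; rewrite ltnW // ltnNge.
  by apply: contraNN xy => /H'_common /(independentP _ _ S_indep x y xS yS) ->.
apply: subset_leq_card; apply/subsetP=> y; rewrite inE => /bigcupP yU.
have [x xS xy] : exists2 x, x \in S & H x y.
  have [yS|yS] := boolP (y \in S); first by exists y.
  apply/exists_inP; apply: contraT => /exists_inPn no.
  have : #|y |: S| <= #|S|.
    apply/S_max/independentP => a b /setU1P[->|aS] /setU1P[->|bS] //.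
    - by rewrite H_sym (negPf (no b bS)).
    - by rewrite (negPf (no a aS)).
    by apply: independent_center.
  by rewrite cardsU1 yS ltnn.
have [x' x'S /andP[x'y x'x]] : exists2 x', x' \in S & H x' y && (x' != x).
  apply/exists_inP; apply: contraT => /exists_inPn no; case: yU; exists x => //.
  rewrite inE xy; apply/forall_inP => z zS; apply/implyP => zy.
  by have := no z zS; rewrite zy /= negbK.
apply/bigcupP; exists (exist _ x' x'S, exist _ x xS); first by rewrite -val_eqE.
by rewrite inE /= x'y xy.
Qed.
End Clusters.

(** The bipartite double cover on [T * bool] decides: a path joining the two lifts of [x] projects
    to an odd closed walk, and shortening it bounds its length. *)
Lemma odd_walk_or_coloring (T : finType) (Q : rel T) : symmetric Q ->
  (exists c : T -> bool, forall x y, Q x y -> c x != c y) \/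
  (exists (x : T) (b : bool) (p : seq (T * bool)),
    [/\ path (fun u v => Q u.1 v.1 && (u.2 != v.2)) (x, b) p,
        last (x, b) p = (x, ~~ b) & size p <= 2 * #|T|]).
Proof.
move=> Qsym; pose e : rel (T * bool) := fun u v => Q u.1 v.1 && (u.2 != v.2).
have e_sym : connect_sym e.
  by apply: sym_connect_sym => u v; rewrite /e Qsym eq_sym.
have [[x /connectP[p0 ep0 lp0]]|no] := altP (@existsP _ (fun x => connect e (x, true) (x, false))).
  right; move: lp0; case/shortenP: ep0 => p ep up _ lp.
  exists x, true, p; split=> //.
  have := card_uniqP up => /= c; have := max_card (mem ((x, true) :: p)).
  by rewrite c card_prod card_bool mulnC => /ltnW.
(* Adjacent vertices have the component roots of their two lifts interchanged, so comparing the
   ranks of these roots is a proper colouring. *)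
left; pose r x b := enum_rank (fingraph.root e (x, b)).
exists (fun x => r x true < r x false) => x y Qxy.
have rE b : r x b = r y (~~ b).
  congr enum_rank; apply/eqP; rewrite root_connect //.
  by apply: connect1; rewrite /e /= Qxy; case: b.
rewrite !rE /=; have : r y true != r y false.
  apply: contraNneq no => /enum_rank_inj/eqP; rewrite root_connect // => c.
  by apply/existsP; exists y.
by rewrite -val_eqE /=; case: ltngtP.
Qed.

Lemma bigminn_leq (I : finType) (F : I -> nat) (a : nat) (i : I) :
  \big[minn/a]_j F j <= F i.
Proof.
have : i \in index_enum I by rewrite mem_index_enum.
elim: (index_enum I) => // j s IH; rewrite inE big_cons => /orP[/eqP <-|/IH h].
  exact: geq_minl.
exact: leq_trans (geq_minr _ _) h.
Qed.

Lemma gamma2_leq (G : sgraph) (c : pred G) :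
  gamma2 G <= #|[set p : G * G | adj p.1 p.2 && (c p.1 == c p.2)]|.
Proof.
have induced_leq X : #|edges (@induced G X)|
    <= #|[set p : G * G | [&& adj p.1 p.2, p.1 \in X & p.2 \in X]]|.
  apply: leq_trans (leq_imset_card _ _) _.
  have f_inj : injective (fun p : induced X * induced X => (val p.1, val p.2)).
    by move=> [x y] [x' y'] [/val_inj -> /val_inj ->].
  rewrite -(card_imset _ f_inj); apply: subset_leq_card.
  apply/subsetP=> _ /imsetP[[x y] xy ->]; rewrite !inE /= !(valP x) !(valP y) !andbT.
  by move: xy; rewrite inE.
apply: leq_trans (bigminn_leq _ _ [set x | c x]) _.
apply: leq_trans (leq_add (induced_leq _) (induced_leq _)) _.
rewrite -cardsUI [X in _ + X]eq_card0 ?addn0.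
  apply: subset_leq_card; apply/subsetP=> p; rewrite !inE.
  by case: adj => //=; case: (c p.1); case: (c p.2).
by move=> p; rewrite !inE; case: adj => //=; case: (c p.1); rewrite ?andbF.
Qed.

(** * Linkage by lazy walks *)

Section NearBipartite.
Variables (G : sgraph) (N g0 : nat).
Let n := #|G|.
Hypotheses (N_gt0 : 0 < N) (Nn : N <= n).

(** The threshold reproduces itself: [N] midpoints with [N ^ L.-1] walks on either side give
    [N ^ (2 * L).-1]. Asking for both directions gives symmetry at once. *)
Definition linked (s : nat) : rel G := fun x y =>
  (N ^ (2 ^ s.+1).-1 <= lazy_walks N (2 ^ s.+1) false x y)
  && (N ^ (2 ^ s.+1).-1 <= lazy_walks N (2 ^ s.+1) false y x).

Lemma linked_sym (s : nat) : symmetric (linked s).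
Proof. by move=> x y; rewrite /linked andbC. Qed.

Lemma linked_refl (s : nat) : reflexive (linked s).
Proof.
move=> x; rewrite /linked andbb.
have -> : 2 ^ s.+1 = (2 ^ s.+1).-1 + 1 by have := expn_gt0 2 s.+1; lia.
rewrite {1}addn1 /= -[X in X <= _]muln1.
apply: leq_trans (lazy_walks_pause _ _ _ _ _ _).
rewrite leq_mul2l /= eqxx; lia.
Qed.

Lemma linked_succ (s : nat) : subrel (linked s) (linked s.+1).
Proof.
move=> x y; set L := 2 ^ s.+1; have L0 : 0 < L by rewrite expn_gt0.
have step u v : N ^ L.-1 <= lazy_walks N L false u v ->
    N ^ (2 ^ s.+2).-1 <= lazy_walks N (2 ^ s.+2) false u v.
  rewrite (expnS 2 s.+1) -/L mul2n -addnn => h.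
  apply: leq_trans (lazy_walks_pause _ _ _ _ _ _).
  have -> : (L + L).-1 = L + L.-1 by lia.
  by rewrite expnD leq_mul2l h orbT.
by case/andP=> h1 h2; rewrite /linked !step.
Qed.

Lemma linked_common (s : nat) (x y : G) :
  N <= #|[set z | linked s x z && linked s y z]| -> linked s.+1 x y.
Proof.
set L := 2 ^ s.+1; have L0 : 0 < L by rewrite expn_gt0.
have step u v : N <= #|[set z | linked s u z && linked s v z]| ->
    N ^ (2 ^ s.+2).-1 <= lazy_walks N (2 ^ s.+2) false u v.
  rewrite (expnS 2 s.+1) -/L mul2n -addnn => h.
  apply: leq_trans (lazy_walks_comp N L L false false u v).
  have -> : (L + L).-1 = 1 + (L.-1 + L.-1) by lia.
  rewrite expnD expn1; apply: leq_trans (leq_mul h (leqnn _)) _.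
  rewrite -sum_nat_const [X in _ <= X](bigID (mem [set z | linked s u z && linked s v z])) /=.
  apply: leq_trans (leq_addr _ _); apply: leq_sum => z.
  by rewrite inE expnD => /andP[/andP[h1 _] /andP[_ h2]]; apply: leq_mul.
move=> h; rewrite /linked !step //.
by move: h; congr (_ <= _); apply: eq_card => z; rewrite !inE andbC.
Qed.

Hypothesis codegree_indep : forall S : {set G},
  {in S &, forall x y, x != y -> #|[set z | adj x z && adj y z]| < N} -> #|S| <= g0.

Lemma linked_indep (s : nat) (S : {set G}) : independent (linked s) S -> #|S| <= g0.
Proof.
have sub : subrel (linked 0) (linked s).
  by elim: s => // s IH x y /IH; apply: linked_succ.
move=> /independentP iS; apply: codegree_indep => x y xS yS.
apply: contraNltn => xy; apply/eqP/iS => //; apply: sub.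
rewrite /linked !expn1 (leq_trans xy) ?lazy_walks_codegree //=.
apply: leq_trans xy _; apply: leq_trans (lazy_walks_codegree _ _ _).
by apply: eq_leq; apply: eq_card => z; rewrite !inE andbC.
Qed.

(** The maximum size of an independent set is at most [g0] at scale 0, so it cannot drop at each of
    [g0 + 1] successive scales. *)
Lemma stable_scale : exists (s : nat) (S : {set G}),
  [/\ s <= g0, independent (linked s.+1) S
    & forall S', independent (linked s) S' -> #|S'| <= #|S|].
Proof.
pose a s := \max_(S | independent (linked s) S) #|S|.
have aE s : {S | independent (linked s) S & a s = #|S|}.
  apply: eq_bigmax_cond; apply/card_gt0P; exists set0.
  by apply/independentP => x y; rewrite inE.
suff [s sg sa] : exists2 s, s <= g0 & a s <= a s.+1.
  have [S iS aS] := aE s.+1; exists s, S; split=> // S' iS'.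
  by rewrite -aS; apply: leq_trans sa; apply: leq_bigmax_cond.
have [s0 _] := aE 0.
suff H k : k <= g0.+1 -> (exists2 s, s <= g0 & a s <= a s.+1) \/ a k + k <= g0.
  have [//|] := H g0.+1 (leqnn _); lia.
elim: k => [|k IH] kg.
  by right; have [S iS ->] := aE 0; rewrite addn0; apply: linked_indep iS.
have [h|h] := IH (ltnW kg); first by left.
have [le|gt] := leqP (a k) (a k.+1); first by left; exists k.
by right; lia.
Qed.

Hypothesis few_closed : forall L, L <= 2 * g0 * (2 ^ g0.+1).+1 + 2 ^ g0.+1 ->
  \sum_(x : G) lazy_walks N L true x x < N ^ L.

(** The factor 3 counts ordered pairs: two families meet the unclustered vertices, and one joins
    clusters spanning fewer than [n * N] pairs. *)
Lemma gamma2_small : gamma2 G <= 3 * g0 ^ 2 * (n * N).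
Proof.
have [s [S [sg iS maxS]]] := stable_scale.
have cS : #|S| <= g0 by apply: linked_indep iS.
set H := linked s in maxS; set L := 2 ^ s.+1.
have L0 : 0 < L by rewrite expn_gt0.
pose T := {x : G | x \in S}.
have cT : #|{: T}| = #|S| by rewrite card_sig.
pose U (x : T) := cluster H S (val x).
have U_link x u v : u \in U x -> v \in U x -> N ^ L.-1 <= lazy_walks N L false u v.
  move=> uU vU; suff /andP[] : linked s u v by [].
  exact: (cluster_related (@linked_refl s) (@linked_sym s) (@linked_succ s) iS maxS (valP x) uU vU).
pose E (x y : T) := [set p : G * G | [&& adj p.1 p.2, p.1 \in U x & p.2 \in U y]].
(* A cluster may be related to itself; such a loop already is an odd closed walk. *)
pose Q (x y : T) := n * N <= #|E x y|.
have Q_sym : symmetric Q.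
  suff H1 x y : Q x y -> Q y x by move=> x y; apply/idP/idP; apply: H1.
  move=> h; apply: leq_trans h _.
  have f_inj : injective (fun p : G * G => (p.2, p.1)) by case=> a b [c d] [-> ->].
  rewrite -(card_imset _ f_inj); apply: subset_leq_card.
  apply/subsetP=> _ /imsetP[[u v] /[!inE] /= /and3P[uv uU vU] ->].
  by rewrite adj_sym uv uU vU.
have [[c cQ]|[x [b [p [ep lp sp]]]]] := odd_walk_or_coloring Q_sym; last first.
  (* Each crossing offers [n * N >= N ^ 2] edges, which makes up for the exponent lost by the lazy
     walks on both sides. *)
  have walk (q : seq (T * bool)) y d : path (fun u v => Q u.1 v.1 && (u.2 != v.2)) (y, d) q ->
      forall u v, u \in U y -> v \in U (last (y, d) q).1 ->
      N ^ (size q * L.+1 + L).-1 <=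
        lazy_walks N (size q * L.+1 + L) (d (+) (last (y, d) q).2) u v.
    elim: q y d => [|[z e] q IH] y d.
      by move=> _ u v; rewrite mul0n add0n addbb; apply: U_link.
    set M := size q * L.+1 + L.
    have -> : size ((z, e) :: q) * L.+1 + L = L + (1 + M) by rewrite [size _]/= mulSn /M; lia.
    set K := L + (1 + M) => /=; rewrite /K {K}; set f := last _ _ => /andP[/andP[yz de] eq] u v uU vU.
    have -> : d (+) f.2 = false (+) (true (+) (e (+) f.2)).
      have -> : d = ~~ e by move: de; case: (d); case: (e).
      by rewrite addNb.
    apply: leq_trans (lazy_walks_comp _ _ _ _ _ _ _).
    apply: (@leq_trans (\sum_u1 \sum_v1 lazy_walks N L false u u1 *
        (lazy_walks N 1 true u1 v1 * lazy_walks N M (e (+) f.2) v1 v))); last first.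
      apply: leq_sum => u1 _; rewrite -big_distrr /= leq_mul2l.
      by rewrite (lazy_walks_comp N 1 M true (e (+) f.2) u1 v) orbT.
    rewrite pair_bigA /= [X in _ <= X](bigID (mem (E y z))) /=.
    apply: leq_trans (leq_addr _ _).
    apply: (@leq_trans (\sum_(p in E y z) N ^ (L.-1 + M.-1))).
      rewrite sum_nat_const.
      have -> : (L + (1 + M)).-1 = 2 + (L.-1 + M.-1) by rewrite /M; lia.
      rewrite expnD leq_mul2r; apply/orP; right; apply: leq_trans yz.
      by rewrite expnS expn1 leq_mul2r Nn orbT.
    apply: leq_sum => -[u1 v1]; rewrite inE /= => /and3P[u1v1 u1U v1U].
    rewrite expnD leq_mul ?(U_link y) //; apply: leq_trans (IH z e eq v1 v v1U vU) _.
    by rewrite leq_pmull // lazy_walk_adj.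
  (* The first crossing has [n * N] pairs starting in [U x], each vertex being in at most [n] of
     them. Summing over these starting points yields [N * N ^ M.-1], against [few_closed]. *)
  have UN : N <= #|U x|.
    case: p ep lp {sp} => [|[y e] p] /=; first by case: (b) => _ [].
    case/andP=> /andP[xy _] _ _.
    rewrite -(@leq_pmul2l n); last exact: leq_trans Nn.
    apply: leq_trans xy _; rewrite mulnC -[n]cardsT -cardsX.
    by apply: subset_leq_card; apply/subsetP=> -[u v]; rewrite !inE /= andbT => /and3P[].
  exfalso; have := walk p x b ep; rewrite lp /=.
  have -> : b (+) ~~ b = true by case: (b).
  set M := size p * L.+1 + L => wM.
  have /few_closed : M <= 2 * g0 * (2 ^ g0.+1).+1 + 2 ^ g0.+1.
    have LL : L <= 2 ^ g0.+1 by rewrite leq_exp2l.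
    by rewrite leq_add // leq_mul // (leq_trans sp) // cT leq_mul2l cS orbT.
  rewrite ltnNge => /negP; apply.
  apply: (@leq_trans (\sum_(u in U x) N ^ M.-1)).
    rewrite sum_nat_const -{1}(@prednK M) ?expnS ?leq_mul2r ?UN ?orbT //.
    by rewrite /M; lia.
  rewrite [X in _ <= X](bigID (mem (U x))) /=; apply: leq_trans (leq_addr _ _).
  by apply: leq_sum => u uU; apply: wM.
pose center v := [pick x : T | v \in U x].
(* The default colour is harmless: all edges at unclustered vertices are counted as deleted. *)
pose col v := if center v is Some x then c x else true.
pose B := unclustered H S.
have cB : #|B| <= #|S| ^ 2 * N.
  exact: (card_unclustered (@linked_refl s) (@linked_sym s) (@linked_succ s)
    (@linked_common s) iS maxS).
have colU v : v \notin B -> exists2 x, v \in U x & col v = c x.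
  rewrite inE negbK => /bigcupP[x xS vx]; rewrite /col /center.
  case: pickP => [y vy|/(_ (exist _ x xS))]; first by exists y.
  by rewrite /U /= vx.
apply: leq_trans (gamma2_leq col) _.
pose W := \bigcup_(p : T * T | ~~ Q p.1 p.2) E p.1 p.2.
have cW : #|W| <= #|S| ^ 2 * (n * N).
  apply: leq_trans (card_bigcup_leq (c := n * N) _) _.
    by move=> p; rewrite -ltnNge => /ltnW.
  by rewrite card_prod cT.
apply: (@leq_trans #|(setX B setT :|: setX setT B) :|: W|).
  apply: subset_leq_card; apply/subsetP=> -[u v]; rewrite [X in is_true X -> _]inE /=.
  case/andP=> uv /eqP cuv; rewrite 2!in_setU !in_setX !in_setT /= andbT.
  have [//|/colU[x ux cx]] := boolP (u \in B).
  have [//|/colU[y vy cy]] := boolP (v \in B).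
  apply/bigcupP; exists (x, y); last by rewrite inE /= uv ux vy.
  by apply/negP => /cQ; rewrite -cx -cy cuv eqxx.
apply: leq_trans (leq_card_setU _ _).1 _.
apply: leq_trans (leq_add (leq_card_setU _ _).1 cW) _.
rewrite !cardsX !cardsT -/n.
have S2 : #|S| ^ 2 <= g0 ^ 2 by rewrite leq_exp2r.
move: cB S2 {cW}; set w := #|S| ^ 2; set z := g0 ^ 2 => cB S2.
have h1 : n * #|B| <= n * (w * N) by rewrite leq_mul2l cB orbT.
have h2 : w * (n * N) <= z * (n * N) by rewrite leq_mul2r S2 orbT.
nia.
Qed.
End NearBipartite.

(** Second moment: for [f z] neighbours of [z] among [m] vertices of [S], summing
    [2 * f z <= f z ^ 2 + 1] bounds their degree sum by [m ^ 2 * N + #|G|], less than [m * d]. *)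
Lemma codegree_independent_card (G : sgraph) (N m d : nat) :
  m ^ 2 * N < #|G| -> (forall x : G, d <= degree x) -> 2 * #|G| <= m * d ->
  forall S : {set G},
    {in S &, forall x y, x != y -> #|[set z | adj x z && adj y z]| < N} -> #|S| < m.
Proof.
move=> mN dG md S codeg; rewrite ltnNge; apply/negP => mS.
have [S' sS' cS'] : exists2 S' : {set G}, S' \subset S & #|S'| = m.
  have /set0Pn[S'] : [set A : {set G} | A \subset S & #|A| == m] != set0.
    by rewrite -card_gt0 cards_draws bin_gt0.
  by rewrite inE => /andP[h /eqP h']; exists S'.
pose f z := #|[set x in S' | adj x z]|.
have sum_f : \sum_z f z = \sum_(x in S') degree x.
  under eq_bigr => z _ do rewrite /f -sum1_card.
  under [RHS]eq_bigr => x _ do rewrite /degree -sum1_card.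
  rewrite (exchange_big_dep (mem S')) /=; last by move=> z x _; rewrite inE => /andP[].
  by apply: eq_bigr => x xS; apply: eq_bigl => z; rewrite !inE xS.
have sum_f2 : \sum_z f z ^ 2 <= \sum_(x in S') degree x + m ^ 2 * N.
  have -> : \sum_z f z ^ 2 = \sum_(x in S') \sum_(y in S') #|[set z | adj x z && adj y z]|.
    rewrite pair_big_dep /=.
    under [RHS]eq_bigr => p _ do rewrite -sum1_card.
    rewrite (exchange_big_dep predT) //=; apply: eq_bigr => z _.
    rewrite sum1_card expnS expn1 /f -cardsX; apply: eq_card => -[x y].
    by rewrite in_setX !inE andbACA -[RHS]topredE /= inE.
  rewrite -cS' expnS expn1 -mulnA -sum_nat_const -big_split /=.
  apply: leq_sum => x xS; rewrite (bigD1 x) //= leq_add //.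
    by apply: eq_leq; apply: eq_card => z; rewrite !inE andbb.
  rewrite -sum_nat_const [X in _ <= X](bigD1 x) //=; apply: leq_trans (leq_addl _ _).
  apply: leq_sum => y /andP[yS yx]; apply: ltnW.
  by apply: codeg; [exact: (subsetP sS')|exact: (subsetP sS')|rewrite eq_sym].
have two_f : 2 * \sum_z f z <= \sum_z f z ^ 2 + #|G|.
  rewrite -sum1_card big_distrr -big_split; apply: leq_sum => z _ /=.
  by have := (nat_Cauchy (f z) 1).1; rewrite muln1.
have : m * d <= \sum_(x in S') degree x.
  by rewrite -cS' -sum_nat_const; apply: leq_sum => x _; apply: dG.
rewrite sum_f in two_f; lia.
Qed.

(** * Choice of the parameters *)

Lemma root_floor (P M n : nat) : 0 < M -> P ^ M <= n ->
  exists p, [/\ P <= p, p ^ M <= n & n < p.+1 ^ M].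
Proof.
move=> M0 Pn; have hP : exists p, (P <= p) && (p ^ M <= n) by exists P; rewrite leqnn.
have bnd p : (P <= p) && (p ^ M <= n) -> p <= n.
  by case/andP=> _; apply: leq_trans; rewrite -{1}(expn1 p); case: p => // p; rewrite leq_pexp2l.
case: (ex_maxnP hP bnd) => p /andP[Pp pn] pmax; exists p; split=> //.
rewrite ltnNge; apply/negP => h; have := pmax p.+1.
by rewrite h (leq_trans Pp) // ltnn => /(_ isT).
Qed.

(** Integer form of the theorem: [p] plays the part of a small power of [n], and [1 / e] that of the
    degree surplus. *)
Lemma gamma2_bound (g t e : nat) : 1 < g -> 0 < t -> exists C M P : nat,
  [/\ 0 < C, 0 < M, 0 < P & forall (G : sgraph) (p : nat),
    P <= p -> p ^ M <= #|G| ->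
    (forall x : G, (2 * e + 1) * #|G| <= e * (2 * g + 1) * degree x) ->
    ~ contains_copy (blowup (cycle_graph (2 * g - 1)) t) G ->
    gamma2 G * p <= C * #|G| ^ 2].
Proof.
move=> g1 t0; set L := 2 * g - 1; pose m := 2 * g + 1.
have oL : odd L by rewrite oddB ?oddM //; lia.
have L2 : 2 < L by lia.
have Lm : L + 2 = m by rewrite /L /m; lia.
pose B := 2 * (2 * g) * (2 ^ (2 * g).+1).+1 + 2 ^ (2 * g).+1.
have [D [E short]] := few_short_odd_closed_walks oL t0.
have [K few] := few_odd_closed_walks e B oL L2.
(* The exponent ensures [D * q ^ E <= n] for [q = p ^ B.+1]. The last bound puts [p] above [D],
   above [K * 4 ^ B] for the lazy walks, and above [m ^ 2] for the codegrees. *)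
exists (3 * (2 * g) ^ 2), (B.+1 * E).+2, (D + K * 4 ^ B + m ^ 2).+1.
split=> // [|G p Pp pn dG noC]; first by rewrite muln_gt0 expn_gt0; lia.
set n := #|G| in pn dG *.
have p0 : 0 < p by lia.
have pp k : 0 < p ^ k by rewrite expn_gt0 p0.
have pn1 : p <= n by apply: leq_trans pn; rewrite expnS leq_pmulr.
have n0 : 0 < n by apply: leq_trans pn1.
pose q := p ^ B.+1; pose N := n %/ p.
have N0 : 0 < N by rewrite divn_gt0.
have Nn : N <= n by rewrite leq_div.
have Np : N * p <= n by rewrite leq_trunc_div.
have np : n <= 2 * p * N.
  have := ltn_ceil n p0; rewrite -/N; nia.
have hq : D * q ^ E <= n.
  apply: leq_trans pn; rewrite /q -expnM 2!expnS; apply: leq_mul; first by lia.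
  exact: leq_pmull.
have few1 l : odd l -> l <= B -> closed_walks G l * q <= K * n ^ l.
  apply: few => // [x|]; first by rewrite Lm; apply: dG.
  exact: (short G q noC (pp _) n0 hq).
(* Passing from [n] to [N] costs [(2 * p) ^ l] and the pauses cost [2 ^ l]; the extra factor [p] in
   [q] absorbs [K * 4 ^ B]. *)
have few2 (l : nat) : l <= B -> \sum_(x : G) lazy_walks N l true x x < N ^ l.
  move=> lB; have := lazy_walks_bound Nn few1 lB; rewrite -/n.
  have Nl : n ^ l <= 2 ^ l * p ^ l * N ^ l by case: (l) => // k; rewrite -!expnMn leq_exp2r.
  set S := \sum_x _ => hS; rewrite -(@ltn_pmul2r q) ?pp //.
  apply: leq_ltn_trans hS _; apply: leq_ltn_trans (leq_mul (leqnn _) Nl) _.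
  have -> : K * 2 ^ l * (2 ^ l * p ^ l * N ^ l) = K * 4 ^ l * (p ^ l) * N ^ l.
    by rewrite -[4]/(2 * 2) expnMn; ring.
  rewrite mulnC ltn_pmul2l ?expn_gt0 ?N0 // /q expnS.
  apply: (@leq_ltn_trans (K * 4 ^ B * p ^ B)).
    by rewrite leq_mul ?leq_mul ?leq_pexp2l.
  by rewrite ltn_pmul2r //; lia.
have [d hd dE] : exists2 d, (2 * e + 1) * n <= e * m * d & forall x : G, d <= degree x.
  have /card_gt0P[x0 _] := n0.
  exists (degree [arg min_(x < x0) degree x]) => [|x]; first exact: dG.
  by case: arg_minnP => // y _; apply.
have md : 2 * n <= m * d.
  rewrite leqNgt; apply/negP => /ltnW le.
  have : e * (m * d) <= e * (2 * n) by rewrite leq_mul2l le orbT.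
  by move: hd; lia.
have mN : m ^ 2 * N < n.
  apply: leq_trans Np; rewrite mulnC ltn_pmul2l //; lia.
have indep (A : {set G}) :
    {in A &, forall x y, x != y -> #|[set z | adj x z && adj y z]| < N} -> #|A| <= 2 * g.
  by move=> /(codegree_independent_card mN dE md); rewrite /m addn1 ltnS.
have := gamma2_small N0 Nn indep few2; rewrite -/n => h.
apply: leq_trans (leq_mul h (leqnn p)) _.
by rewrite expnS expn1 -!mulnA !leq_mul2l Np !orbT.
Qed.

(** * From integer bounds to real exponents *)

Import Order.TTheory GRing.Theory Num.Theory.
Local Open Scope ring_scope.

Theorem theorem1p3 (R : realType) (g t : nat) (eps : R)
    (hg : (2 <= g)%N) (ht : (1 <= t)%N) (heps : 0 < eps) :
  exists (C rho : R) (n0 : nat),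
    [/\ 0 < C, 0 < rho &
        forall n : nat, (n0 <= n)%N ->
        forall G : sgraph, #|G| = n ->
          (min_degree G)%:R >= (2%:R / (2 * g + 1)%:R + eps) * n%:R ->
          contains_copy (blowup (cycle_graph (2 * g - 1)) t) G \/
          (gamma2 G)%:R <= C * n%:R `^ (2%:R - rho)].
Proof.
have [e he] : exists e : nat, 1 <= e%:R * eps.
  exists (Num.bound eps^-1); rewrite -ler_pdivrMr // mul1r ltW //.
  by rewrite archi_boundP // ltW // invr_gt0.
have [C [M [P [C0 M0 P0 bound]]]] := gamma2_bound e hg ht.
(* With [p] the integer [M]-th root of [n], [n] to the power [1 / M] is at most [p + 1 <= 2 * p];
   hence the doubled constant. *)
exists (2 * C%:R), M%:R^-1, (P ^ M)%N; split.
- by rewrite mulr_gt0 ?ltr0n.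
- by rewrite invr_gt0 ltr0n.
move=> n Pn G cG dG.
have [|noC] := pselect (contains_copy (blowup (cycle_graph (2 * g - 1)) t) G); first by left.
right; have [p [Pp pn np]] := root_floor M0 Pn.
have p0 : (0 < p)%N by apply: leq_trans Pp.
have n0 : (0 < n)%N by apply: leq_trans pn; rewrite expn_gt0 p0.
have deg (x : G) : ((2 * e + 1) * #|G| <= e * (2 * g + 1) * degree x)%N.
  have dx : (min_degree G <= degree x)%N by apply: bigminn_leq.
  rewrite cG; apply: (@leq_trans (e * (2 * g + 1) * min_degree G)); last by rewrite leq_mul2l dx orbT.
  rewrite -(ler_nat R) !natrM.
  apply: le_trans (ler_wpM2l _ dG); last by rewrite mulr_ge0 ?ler0n.
  set m : R := (2 * g + 1)%:R.
  have m1 : 1 <= m by rewrite ler1n; lia.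
  clearbody m.
  (* Clearing denominators turns the surplus [eps] into [m * (e * eps) >= 1]. *)
  have -> : e%:R * m * ((2%:R / m + eps) * n%:R) = (2 * e%:R + m * (e%:R * eps)) * n%:R.
    by field; apply/eqP => m0; rewrite m0 ler10 in m1.
  rewrite natrD natrM ler_wpM2r ?ler0n // lerD2l.
  by rewrite -[1%:R]mulr1 ler_pM ?ler01.
have pG : (p ^ M <= #|G|)%N by rewrite cG.
have := bound G p Pp pG deg noC; rewrite cG -(ler_nat R) natrM [(C * _)%:R]natrM natrX => h.
have nR : 0 < n%:R :> R by rewrite ltr0n.
have pR : 0 < p%:R :> R by rewrite ltr0n.
have root : n%:R `^ M%:R^-1 <= 2 * p%:R :> R.
  have p2 : 0 <= 2 * p%:R :> R by rewrite mulr_ge0.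
  have -> : 2 * p%:R = ((2 * p%:R) ^+ M) `^ M%:R^-1 :> R.
    by rewrite -powR_mulrn // -powRrM mulfV ?powRr1 // pnatr_eq0 -lt0n.
  apply: ge0_ler_powR; rewrite ?invr_ge0 ?nnegrE ?ler0n ?exprn_ge0 //.
  rewrite -natrM -natrX ler_nat; apply: leq_trans (ltnW np) _.
  by rewrite leq_exp2r //; lia.
rewrite powRD; last by rewrite (gt_eqF nR) implybT.
rewrite powRN powR_mulrn ?ler0n //.
set r := n%:R `^ M%:R^-1 in root *.
have r0 : 0 < r by rewrite powR_gt0.
rewrite -(ler_pM2r pR); apply: le_trans h _.
have -> : 2 * C%:R * (n%:R ^+ 2 * r^-1) * p%:R = C%:R * n%:R ^+ 2 * ((2 * p%:R) / r) by ring.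
by rewrite ler_peMr ?mulr_ge0 ?exprn_ge0 ?ler0n // ler_pdivlMr // mul1r.
Qed.
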